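(* For all integers $m,n\ge 2$, \[ W(D_{m,n})=\tfrac{1}{12}\big(10m^3n^2+10m^2n^3-6m^3n-24m^2n^2-6mn^3+4m^3+14m^2n+14mn^2+4n^3-12mn-4m-4n\big). \]
   Context: For a digraph $D$, $d_D(u,v)$ is the length of a shortest directed path from $u$ to $v$, and $d_D(u,v)=0$ if there is no such path. The Wiener index is $W(D)=\sum_{(u,v)\in V(D)\times V(D)} d_D(u,v)$, the sum over all ordered pairs. The grid $G_{m,n}=P_m\Box P_n$ has vertices $(i,j)$, $1\le i\le m$ (row, row $1$ being the top row), $1\le j\le n$ (column), with $(i,j)$ adjacent to $(i\pm1,j)$ and $(i,j\pm1)$. $D_{m,n}$ is the orientation of $G_{m,n}$ in which: for each column $j$ with $1\le j\le n-1$ the vertical edges are oriented upward, $(i+1,j)\to(i,j)$; in column $n$ they are oriented downward, $(i,n)\to(i+1,n)$; row $1$ is oriented to the right, $(1,j)\to(1,j+1)$; and every row $i$ with $2\le i\le m$ is oriented to the left, $(i,j+1)\to(i,j)$. *)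

(* Defs.v *)
From mathcomp Require Import all_boot all_order all_algebra.

Set Implicit Arguments.
Unset Strict Implicit.
Unset Printing Implicit Defensive.

(* A digraph on a finite vertex set T is given by its arc relation e : rel T. *)

Definition is_dipath (T : finType) (e : rel T) (u v : T) (p : seq T) : bool :=
  [&& path e u p, last u p == v & uniq (u :: p)].

Definition has_dipath (T : finType) (e : rel T) (u v : T) (k : nat) : bool :=
  [exists p : k.-tuple T, is_dipath e u v p].

(* A directed path has distinct vertices, hence length < #|T|: the filtered
   list contains the lengths of all directed paths from u to v, in increasing
   order, and [head] returns the default value 0 when there is none. *)
Definition didist (T : finType) (e : rel T) (u v : T) : nat :=
  head 0 [seq k <- iota 0 #|T| | has_dipath e u v k].

Definition wiener (T : finType) (e : rel T) : nat :=
  \sum_(uv : T * T) didist e uv.1 uv.2.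

(* The vertex (i, j), 1 <= i <= m and 1 <= j <= n, is encoded by the 0-based
   pair (i - 1, j - 1) : 'I_m * 'I_n; row 0 is the top row and column n - 1 is
   the last one. *)
Definition Dgrid (m n : nat) : rel ('I_m * 'I_n) := fun u v =>
  if u.2 == v.2 then
    (* vertical arcs: down in the last column, up in the others *)
    if u.2.+1 == n then v.1 == u.1.+1 :> nat else u.1 == v.1.+1 :> nat
  else if u.1 == v.1 then
    (* horizontal arcs: right in the top row, left in the others *)
    if u.1 == 0 :> nat then v.2 == u.2.+1 :> nat else u.2 == v.2.+1 :> nat
  else false.
Arguments Dgrid m n : clear implicits.

(* Main.v *)
Require Import Defs.
From mathcomp Require Import all_boot all_order all_algebra.
From mathcomp Require Import zify ring.

(** All distances have an explicit form. If a vertex function [f] vanishes at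
    [v], drops by at most one along every arc, and drops by exactly one along
    some arc out of each other vertex, then [f] is the distance to [v]. This
    applies to the length [grid_dist] of the obvious routes: go left and then up
    when the target lies up and to the left, and otherwise go around through
    the top row, the last column and the row of the target. The distances are
    then summed over all columns for a fixed pair of rows, and finally over the
    pairs of rows. *)

Import Order.TTheory GRing.Theory Num.Theory.
Local Open Scope ring_scope.

(** * Distances from potential functions *)

Section Potential.
Local Open Scope nat_scope.
Variables (T : finType) (e : rel T) (f : T -> nat) (v : T).
Hypothesis fv : f v = 0.
Hypothesis f_arc : forall x y, e x y -> f x <= (f y).+1.
Hypothesis f_step : forall x, x != v -> exists2 y, e x y & f x = (f y).+1.

Lemma potential_path u p : path e u p -> last u p = v -> f u <= size p.
Proof.
elim: p u => [|y p IHp] u /=; first by move=> _ ->; rewrite fv.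
by case/andP=> /f_arc le_uy e_p /(IHp _ e_p) le_yp; apply: leq_trans le_uy _.
Qed.

(* A walk along which [f] decreases is automatically a path. *)
Lemma potential_dipath u :
  exists p, [/\ is_dipath e u v p, size p = f u & all (fun x => f x < f u) p].
Proof.
have [k fu] : exists k, f u = k by exists (f u).
elim: k u fu => [|k IHk] u fu.
  have [->|/f_step[y _]] := eqVneq u v; last by rewrite fu.
  by exists [::]; rewrite /is_dipath /= fv eqxx.
have /f_step[y e_uy fuy] : u != v by apply/eqP=> uv; rewrite uv fv in fu.
have fy : f y = k by move: fu; rewrite fuy => -[].
have [p [/and3P[e_p /eqP p_v p_uniq] sz_p f_p]] := IHk y fy.
exists (y :: p); have f_yp : all (fun x => f x < f u) (y :: p).
  by rewrite /= fuy ltnS leqnn; apply: sub_all f_p => x /ltnW.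
split=> //; last by rewrite /= sz_p fuy.
rewrite /is_dipath /= e_uy e_p p_v eqxx; move: p_uniq => /= ->; rewrite andbT.
by apply/negP=> /(allP f_yp); rewrite ltnn.
Qed.

(** The decreasing path of [potential_dipath] realizes the length [f u], and [potential_path]
    excludes every shorter path. *)
Lemma didist_potential u : didist e u v = f u.
Proof.
have [p [p_di sz_p _]] := potential_dipath u.
(* A path has distinct vertices, so [f u] lies in the range that [didist] searches. *)
have lt_fu : f u < #|T|.
  by case/and3P: p_di => _ _ /card_uniqP up; rewrite -sz_p -[_.+1]up max_card.
have fuP : has_dipath e u v (f u).
  by apply/existsP; exists (tcast sz_p (in_tuple p)); rewrite val_tcast.
(* Cut the list of candidate lengths at [f u]: nothing before the cut survives the filter, and the
   remainder begins with [f u]. *)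
rewrite /didist -(subnKC (ltnW lt_fu)) iotaD filter_cat.
rewrite (_ : filter _ (iota 0 _) = [::]) /=.
  by case: (#|T| - f u) (subn_gt0 (f u) #|T|) => [|r] /=; rewrite ?lt_fu ?fuP.
apply/eqP; rewrite -[_ == _]negbK -has_filter; apply/hasPn=> k.
rewrite mem_iota add0n => /andP[_ lt_k].
apply/existsP=> -[q /and3P[e_q /eqP q_v _]].
by have := potential_path _ _ e_q q_v; rewrite size_tuple leqNgt lt_k.
Qed.
End Potential.

(* Infeasible branches are pruned at every split: the full tree is too large. *)
Ltac split_ifs := repeat (case: ifP => ?; try (exfalso; lia)).

(** * The explicit distance in the grid *)

Section GridDistance.
Local Open Scope nat_scope.
Variables (M N : nat).

(* [M] and [N] are the last row and column, [(a, b)] is the source and [(c, d)]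
   the target. The final summand is the detour of a path that climbs from one
   vertex of the last column to another, which must leave this column and
   come back. *)
Definition grid_dist (a b c d : nat) : nat :=
  if a < c then (if b < N then a + c + (N - b) + (N - d) else c - a + (N - d))
  else if a == 0 then (if d < b then (N - b) + (N - d) + 2 else d - b)
  else (if c == 0 then a + (b - d) + (d - b)
        else if d < b.+1 then a - c + (b - d)
        else a + c + (N - b) + (N - d))
       + (if (b == N) && (d == N) then (if c < a then c.*2 + 2 else 0) else 0).

Lemma grid_dist0 c d : grid_dist c d c d = 0.
Proof. by rewrite /grid_dist; split_ifs; lia. Qed.

Hypotheses (M_gt0 : 0 < M) (N_gt0 : 0 < N).

Lemma grid_dist_arc (u x v : 'I_M.+1 * 'I_N.+1) : Dgrid M.+1 N.+1 u x ->
  grid_dist u.1 u.2 v.1 v.2 <= (grid_dist x.1 x.2 v.1 v.2).+1.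
Proof.
case: u x v => [[a ha] [b hb]] [[a' ha'] [b' hb']] [[c hc] [d hd]].
rewrite /Dgrid -!val_eqE /=.
by repeat case: ifP => ?; rewrite /grid_dist; split_ifs; lia.
Qed.

(** The witness is the next vertex on the route that [grid_dist] measures. *)
Lemma grid_dist_step (u v : 'I_M.+1 * 'I_N.+1) : u != v ->
  exists2 x, Dgrid M.+1 N.+1 u x &
    grid_dist u.1 u.2 v.1 v.2 = (grid_dist x.1 x.2 v.1 v.2).+1.
Proof.
case: u v => [[a ha] [b hb]] [[c hc] [d hd]].
rewrite -pair_eqE /pair_eq -!val_eqE /= => ne.
suff [a' [b' [ha' [hb' [arc step]]]]] : exists a' b', a' < M.+1 /\ b' < N.+1 /\
  (if b == b' then (if b.+1 == N.+1 then a' == a.+1 else a == a'.+1)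
   else if a == a' then (if a == 0 then b' == b.+1 else b == b'.+1)
   else false) /\ grid_dist a b c d = (grid_dist a' b' c d).+1.
  by exists (Ordinal ha', Ordinal hb').
have [b_N | b_N] := eqVneq b N.
  (* In the last column: down if the target is lower, or from the top right corner, which has no arc
     to the left; otherwise left. *)
  have [down | left] := boolP (if d == N then a < c else (a < c) || (a == 0)).
    exists a.+1, b; move: down.
    by rewrite /grid_dist; split_ifs; repeat split; lia.
  exists a, b.-1; move: left.
  by rewrite /grid_dist; split_ifs; repeat split; lia.
(* In the top row, before the last column, the only outgoing arc leads right. *)
have [a_0 | a_n0] := eqVneq a 0.
  exists a, b.+1.
  by rewrite /grid_dist; split_ifs; repeat split; lia.
(* Elsewhere, moving left helps only towards a target strictly to the left and not lower; any other
   route climbs first. *)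
have [left | up] := boolP ((c <= a) && (d < b)).
  exists a, b.-1.
  by rewrite /grid_dist; split_ifs; repeat split; lia.
exists a.-1, b.
by rewrite /grid_dist; split_ifs; repeat split; lia.
Qed.
End GridDistance.

(** * Sums of piecewise polynomial sequences *)

(** The polynomial form is required only for [i < k]: the truncated subtractions in [grid_dist]
    agree with rational ones only inside the grid. *)
Lemma sum_quadratic (F : nat -> rat) (x y z : rat) k :
    (forall i, (i < k)%N -> F i = x + y * i%:R + z * i%:R ^+ 2) ->
  \sum_(i < k) F i =
  x * k%:R + y * (k%:R * (k%:R - 1) / 2)
  + z * (k%:R * (k%:R - 1) * (2 * k%:R - 1) / 6).
Proof.
elim: k => [|k IHk] FE; first by rewrite big_ord0; field.
rewrite big_ord_recr /= IHk => [|i lt_ik]; last exact/FE/ltnW.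
by rewrite FE // -[k.+1]addn1 natrD; field.
Qed.

Lemma sum_affine (F : nat -> rat) (x y : rat) k :
    (forall i, (i < k)%N -> F i = x + y * i%:R) ->
  \sum_(i < k) F i = x * k%:R + y * (k%:R * (k%:R - 1) / 2).
Proof.
move=> FE; rewrite (sum_quadratic F x y 0) => [|i lt_ik]; first by ring.
by rewrite FE // mul0r addr0.
Qed.

(** Sum the second affine form over the whole range, then correct by the difference of the two forms
    over the first [j] indices. *)
Lemma sum_affine2 (F : nat -> rat) j (x y x' y' : rat) k : (j <= k)%N ->
    (forall i, (i < k)%N ->
       F i = if (i < j)%N then x + y * i%:R else x' + y' * i%:R) ->
  \sum_(i < k) F i = (x - x') * j%:R + (y - y') * (j%:R * (j%:R - 1) / 2)
                     + (x' * k%:R + y' * (k%:R * (k%:R - 1) / 2)).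
Proof.
move=> le_jk FE; rewrite -(sum_affine (fun i => x' + y' * i%:R) x' y' k) //.
rewrite -(sum_affine (fun i => (x - x') + (y - y') * i%:R)
  (x - x') (y - y') j) //.
rewrite (big_ord_widen k (fun i => (x - x') + (y - y') * i%:R)) //.
rewrite [X in _ = X + _]big_mkcond -big_split; apply: eq_bigr => i _ /=.
by rewrite FE //; case: ifP => _; ring.
Qed.

(** This evaluates the detour summand of [grid_dist]. *)
Lemma sum_corner N (t : rat) :
  \sum_(b < N.+1) \sum_(d < N.+1)
     (if (b == N :> nat) && (d == N :> nat) then t else 0) = t.
Proof.
rewrite (bigD1 ord_max) //= [X in _ + X]big1 => [|b b_N].
  rewrite (bigD1 ord_max) //= eqxx big1 ?addr0 // => d d_N.
  by rewrite (_ : (d == N :> nat) = false) //; apply: negbTE.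
by rewrite big1 // => d _;
  rewrite (_ : (b == N :> nat) = false) //; apply: negbTE.
Qed.

(** * Sums over columns, then over rows *)

Section BlockSums.
Variable N : nat.
Notation n := (N.+1%:R : rat).

Definition row_pair_sum a c : rat :=
  \sum_(b < N.+1) \sum_(d < N.+1) (grid_dist N a b c d)%:R.

Let nE : n = N%:R + 1.
Proof. by rewrite -natr1. Qed.

Lemma row_pair_sum_lt a c : (a < c)%N ->
  row_pair_sum a c = n ^+ 2 * (c%:R + n - 1) + a%:R * n * (n - 2).
Proof.
(* A source in the last column goes straight down, so the term [b = N] is split off; the other inner
   sums are affine in [b]. *)
move=> lt_ac; rewrite /row_pair_sum /grid_dist lt_ac big_ord_recr /= ltnn.
rewrite (sum_affine (fun d => (c - a + (N - d))%:R)
  (c%:R - a%:R + N%:R) (-1)); last first.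
  by move=> d lt_d; rewrite natrD !natrB; first ring; lia.
rewrite (sum_affine
  (fun b => \sum_(d < N.+1)
    (if (b < N)%N then a + c + (N - b) + (N - d) else c - a + (N - d))%N%:R)
  (n * (a%:R + c%:R + N%:R *+ 2) - n * (n - 1) / 2) (- n)).
  by rewrite nE; field.
move=> b lt_b; rewrite lt_b.
rewrite (sum_affine (fun d => (a + c + (N - b) + (N - d))%:R)
   (a%:R + c%:R + N%:R *+ 2 - b%:R) (-1)).
  by rewrite nE; field.
by move=> d lt_d; rewrite !natrD !natrB; first ring; lia.
Qed.

Lemma row_pair_sum00 : row_pair_sum 0 0 = 2 * n * (n ^+ 2 - 1) / 3.
Proof.
rewrite /row_pair_sum /grid_dist /=.
(* The cut point and the affine forms of the inner sum both depend on [b], which makes it quadratic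
   in [b]. *)
rewrite (sum_quadratic
  (fun b => \sum_(d < N.+1)
    (if (d < b)%N then N - b + (N - d) + 2 else d - b)%N%:R) 
  (n * (n - 1) / 2) (n + 1) (-1)).
  by field.
move=> b lt_b.
rewrite (sum_affine2
  (fun d => (if (d < b)%N then N - b + (N - d) + 2 else d - b)%N%:R)
  b (2 * n - b%:R) (-1) (- b%:R) 1); [by field | by lia |].
move=> d lt_d; rewrite nE; case: ifP => lt_db.
  by rewrite !natrD !natrB; first ring; lia.
by rewrite natrB; first ring; lia.
Qed.

Lemma row_pair_sum_pos0 a :
  row_pair_sum a.+1 0 = n ^+ 2 * a.+1%:R + n * (n ^+ 2 - 1) / 3 + 2.
Proof.
rewrite /row_pair_sum /grid_dist /=.
(* Split off the detour, which occurs only for [b = d = N] and yields the constant 2. *)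
under eq_bigr do (under eq_bigr do rewrite natrD (fun_if (fun k => k%:R));
  rewrite big_split).
rewrite big_split /= -[RHS]/(_ + 2); congr (_ + _); last exact: sum_corner.
rewrite (sum_quadratic
  (fun b => \sum_(d < N.+1) (a.+1 + (b - d) + (d - b))%:R)
   (n * a.+1%:R + n * (n - 1) / 2) (1 - n) 1).
  by field.
move=> b lt_b.
rewrite (sum_affine2 (fun d => (a.+1 + (b - d) + (d - b))%:R)
  b (a.+1%:R + b%:R) (-1) (a.+1%:R - b%:R) 1); [by field | by lia |].
move=> d lt_d; case: ifP => lt_db.
  have -> : (d - b = 0)%N by lia.
  by rewrite !natrD natrB; first ring; lia.
have -> : (b - d = 0)%N by lia.
by rewrite !natrD natrB; first ring; lia.
Qed.

Lemma row_pair_sum_ge a c : (0 < c <= a)%N ->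
  row_pair_sum a c =
  n ^+ 2 * (a%:R + c%:R + n - 1) - n * (n + 1) * c%:R - n * (n ^+ 2 - 1) / 3
  + (if (c < a)%N then 2 * c%:R + 2 else 0).
Proof.
case/andP=> c_gt0 le_ca; rewrite /row_pair_sum /grid_dist ltnNge le_ca /=.
have [-> ->] : (a == 0 = false)%N /\ (c == 0 = false)%N by split; lia.
under eq_bigr do (under eq_bigr do
    rewrite natrD (fun_if (fun k => k%:R) (_ && _));
  rewrite big_split).
rewrite big_split /=; congr (_ + _); last first.
  rewrite sum_corner; case: ifP => // _.
  by rewrite natrD -muln2 natrM mulrC.
rewrite (sum_quadratic
  (fun b => \sum_(d < N.+1)
     (if (d < b.+1)%N then a - c + (b - d) else a + c + (N - b) + (N - d))%N%:R)
  (n * (a%:R + c%:R + 2 * N%:R) - n * (n - 1) / 2 - 2 * c%:R - 2 * N%:R)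
  (- n - 2 * c%:R - 2 * N%:R + 2) 2).
  by rewrite nE; field.
move=> b lt_b.
(* The cut is [b.+1] because targets with [d = b] belong to the direct branch. *)
rewrite (sum_affine2 (fun d =>
    (if (d < b.+1)%N then a - c + (b - d) else a + c + (N - b) + (N - d))%N%:R)
  b.+1 (a%:R - c%:R + b%:R) (-1) (a%:R + c%:R + 2 * N%:R - b%:R) (-1)).
- by rewrite -[b.+1%:R]natr1 nE; field.
- by lia.
by move=> d lt_d; case: ifP => lt_db; rewrite !natrD !natrB; try ring; lia.
Qed.

Lemma row_sum0 M : \sum_(c < M.+1) row_pair_sum 0 c =
  2 * n * (n ^+ 2 - 1) / 3 + n ^+ 2 * (M%:R * (M%:R + 1) / 2 + M%:R * (n - 1)).
Proof.
rewrite big_ord_recl row_pair_sum00; congr (_ + _).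
rewrite (sum_affine (fun c => row_pair_sum 0 c.+1) (n ^+ 3) (n ^+ 2)).
  by field.
by move=> c _; rewrite row_pair_sum_lt // -natr1; ring.
Qed.

Lemma row_sum_pos M a : (0 < a <= M)%N -> \sum_(c < M.+1) row_pair_sum a c =
  (n * (n ^+ 2 - 1) / 3 + n ^+ 2 * (M%:R * (M%:R + 1) / 2 + M%:R * (n - 1)))
  + (n ^+ 2 - n * (n + 1) / 2 - n * (n ^+ 2 - 1) / 3 + n * (n - 2) * M%:R + 1)
    * a%:R
  + (2 * n - n * (n + 1) / 2 + 1) * a%:R ^+ 2.
Proof.
case: a => // a lt_aM; rewrite big_ord_recl row_pair_sum_pos0.
(* The index [c] now stands for row [c.+1]. The detour [2 * c.+1 + 2] needs a strictly higher
   target, the main term also covers equal rows; hence the two cuts [a] and [a.+1]. *)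
rewrite (eq_bigr (fun c : 'I_M => (if (c < a)%N then 4 + 2 * c%:R else 0) +
    if (c < a.+1)%N then n ^+ 2 * (a.+1%:R + c.+1%:R + n - 1)
      - n * (n + 1) * c.+1%:R - n * (n ^+ 2 - 1) / 3
    else n ^+ 2 * (c.+1%:R + n - 1) + a.+1%:R * n * (n - 2))); last first.
  move=> c _; rewrite lift0; case: ifP => lt_ca.
    have -> : (c < a.+1)%N by lia.
    rewrite row_pair_sum_ge ?ltnS; last by lia.
    by rewrite lt_ca -[c.+1%:R]natr1; ring.
  case: ifP => le_ca; last by rewrite row_pair_sum_lt ?add0r //; lia.
  rewrite row_pair_sum_ge ?ltnS; last by lia.
  by rewrite lt_ca; ring.
rewrite big_split /= (sum_affine2
  (fun c => if (c < a)%N then 4 + 2 * c%:R else 0) a 4 2 0 0); first last.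
- by move=> c _; rewrite mul0r addr0.
- by lia.
rewrite (sum_affine2 (fun c =>
    if (c < a.+1)%N then n ^+ 2 * (a.+1%:R + c.+1%:R + n - 1)
      - n * (n + 1) * c.+1%:R - n * (n ^+ 2 - 1) / 3
    else n ^+ 2 * (c.+1%:R + n - 1) + a.+1%:R * n * (n - 2)) a.+1
  (n ^+ 2 * (a.+1%:R + n) - n * (n + 1) - n * (n ^+ 2 - 1) / 3) (- n)
  (n ^+ 3 + a.+1%:R * n * (n - 2)) (n ^+ 2)); first last.
- by move=> c _; rewrite -[c.+1%:R]natr1; case: ifP => _; field.
- by [].
by rewrite -[a.+1%:R]natr1; field.
Qed.

Lemma row_sums M (m := M.+1%:R : rat) :
  \sum_(a < M.+1) \sum_(c < M.+1) row_pair_sum a c = 1 / 12 *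
  (10 * m ^+ 3 * n ^+ 2 + 10 * m ^+ 2 * n ^+ 3
   - 6 * m ^+ 3 * n - 24 * m ^+ 2 * n ^+ 2
   - 6 * m * n ^+ 3 + 4 * m ^+ 3 + 14 * m ^+ 2 * n
   + 14 * m * n ^+ 2 + 4 * n ^+ 3 - 12 * m * n
   - 4 * m - 4 * n).
Proof.
rewrite big_ord_recl row_sum0 /= {}/m.
set C0 :=
  n * (n ^+ 2 - 1) / 3 + n ^+ 2 * (M%:R * (M%:R + 1) / 2 + M%:R * (n - 1)).
set C1 :=
  n ^+ 2 - n * (n + 1) / 2 - n * (n ^+ 2 - 1) / 3 + n * (n - 2) * M%:R + 1.
set C2 := 2 * n - n * (n + 1) / 2 + 1.
(* These coefficients come from expanding [C0 + C1 * x + C2 * x ^+ 2] at [x = a + 1]. *)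
rewrite (sum_quadratic (fun a => \sum_(c < M.+1) row_pair_sum a.+1 c)
  (C0 + C1 + C2) (C1 + 2 * C2) C2).
  by rewrite /C0 /C1 /C2 -[M.+1%:R]natr1; field.
by move=> a lt_a; rewrite row_sum_pos // -/C0 -/C1 -/C2 -natr1; ring.
Qed.
End BlockSums.

(** * From pairs of vertices to pairs of rows *)

Lemma sum_pairs_exchange (A B : finType) (F : A -> B -> A -> B -> nat) :
  (\sum_(uv : (A * B) * (A * B)) F uv.1.1 uv.1.2 uv.2.1 uv.2.2 =
  \sum_a \sum_c \sum_b \sum_d F a b c d)%N.
Proof.
rewrite -(pair_bigA _ (fun u v => F u.1 u.2 v.1 v.2)) /=.
rewrite -(pair_bigA _ (fun a b => \sum_v F a b v.1 v.2)%N) /=.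
apply: eq_bigr => a _; rewrite [RHS]exchange_big /=; apply: eq_bigr => b _.
by rewrite (pair_bigA _ (fun c d => F a b c d)).
Qed.

Theorem theorem2 (m n : nat) (hm : (2 <= m)%N) (hn : (2 <= n)%N) :
  (wiener (Dgrid m n))%:R =
  1 / 12 *
  (10 * m%:R ^+ 3 * n%:R ^+ 2 + 10 * m%:R ^+ 2 * n%:R ^+ 3
   - 6 * m%:R ^+ 3 * n%:R - 24 * m%:R ^+ 2 * n%:R ^+ 2
   - 6 * m%:R * n%:R ^+ 3 + 4 * m%:R ^+ 3 + 14 * m%:R ^+ 2 * n%:R
   + 14 * m%:R * n%:R ^+ 2 + 4 * n%:R ^+ 3 - 12 * m%:R * n%:R
   - 4 * m%:R - 4 * n%:R) :> rat.
Proof.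
case: m n hm hn => [|M] [|N] //; rewrite !ltnS => M_gt0 N_gt0.
rewrite -row_sums /wiener.
rewrite (eq_bigr (fun uv : ('I_M.+1 * 'I_N.+1) * ('I_M.+1 * 'I_N.+1) =>
  grid_dist N uv.1.1 uv.1.2 uv.2.1 uv.2.2)); last first.
  move=> [u v] _ /=.
  apply: (didist_potential _ (Dgrid M.+1 N.+1)
    (fun x : 'I_M.+1 * 'I_N.+1 => grid_dist N x.1 x.2 v.1 v.2)).
  - exact: grid_dist0.
  - by move=> x y; apply: grid_dist_arc.
  - by move=> x; apply: grid_dist_step.
rewrite (sum_pairs_exchange _ _
  (fun (a : 'I_M.+1) (b : 'I_N.+1) c d => grid_dist N a b c d)).
rewrite natr_sum; apply: eq_bigr => a _.
rewrite natr_sum; apply: eq_bigr => c _.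
rewrite natr_sum; apply: eq_bigr => b _; exact: natr_sum.
Qed.
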